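(* Consider $f:\mathbb{R}^2\to\mathbb{R}$ such that for all $\theta\in\mathbb{R}$, $f(x,\theta)=x^2/2$ if $x\ge0$ and $f(x,\theta)=x^2/8$ if $x<0$. Let $\alpha=1$, $\beta=3/4$, and let $$F(x,y,\theta)=\left(x-\alpha\nabla_xf(x,\theta)+\beta(x-y),\ x\right),\qquad (x,y,\theta)\in\mathbb{R}^3.$$ Then the Heavy-Ball algorithm $(x_{k+1},y_{k+1})=F(x_k,y_k,\theta)$, $k\in\mathbb{N}$, converges globally to $0$ (that is, $(x_k,y_k)\to(0,0)$ for every initialization $(x_0,y_0)\in\mathbb{R}^2$ and every $\theta$), and $\nabla f$ is path differentiable. The Clarke Jacobian of $F$ with respect to $(x,y)$ at $(0,0,0)$ is $J_F(0,0,0)=\mathrm{conv}\{M_1,M_2\}$, where $$M_1=\begin{pmatrix}\frac32&-\frac34\\1&0\end{pmatrix},\qquad M_2=\begin{pmatrix}\frac34&-\frac34\\1&0\end{pmatrix},$$ and the product $M_1M_1M_2M_2$ has eigenvalue $-9/8$.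
   Context: Clarke Jacobian of a locally Lipschitz $h:\mathbb{R}^n\to\mathbb{R}^q$ at $z$: the convex hull of all limits $\lim_k\frac{\partial h}{\partial z}(z_k)$ with $z_k\to z$ and $h$ differentiable at $z_k$. Path differentiable: a locally Lipschitz $h:\mathbb{R}^n\to\mathbb{R}^q$ is path differentiable if it admits a conservative Jacobian, i.e. a set-valued map $J:\mathbb{R}^n\rightrightarrows\mathbb{R}^{q\times n}$ with closed graph, locally bounded, nowhere empty, such that for every absolutely continuous $\gamma:[0,1]\to\mathbb{R}^n$, for almost every $t\in[0,1]$, $\frac{d}{dt}h(\gamma(t))=V\dot\gamma(t)$ for all $V\in J(\gamma(t))$. *)

(* Defs.v *)
From HB Require Import structures.
From mathcomp Require Export all_boot all_order all_algebra.
From mathcomp Require Export all_classical all_reals all_analysis.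
Export Order.TTheory GRing.Theory Num.Theory numFieldNormedType.Exports.

Set Implicit Arguments.
Unset Strict Implicit.
Unset Printing Implicit Defensive.

Local Open Scope classical_set_scope.
Local Open Scope ring_scope.

(* Points of R^n are row vectors, as in derive.v, whose ['J h z] acts on row
   vectors from the right. Jacobian matrices are nevertheless in the usual
   q x n form: the Jacobian of h at z is [('J h z)^T], and the product V v of
   such a matrix V with a vector v is [v *m V^T]. *)

Definition rv2 (R : realType) (a b : R) : 'rV[R]_2 :=
  \row_(j < 2) (if j == 0 then a else b).

Definition mx2 (R : realType) (a b c d : R) : 'M[R]_2 :=
  \matrix_(i < 2, j < 2)
    (if i == 0 then (if j == 0 then a else b) else (if j == 0 then c else d)).

Definition convex_hull (R : realType) (M : lmodType R) (A : set M) : set M :=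
  smallest (@convex_set R M) A.

Definition clarke_jacobian (R : realType) (n q : nat)
    (h : 'rV[R]_n -> 'rV[R]_q) (z : 'rV[R]_n) : set 'M[R]_(q, n) :=
  convex_hull [set V : 'M[R]_(q, n) | exists zk : nat -> 'rV[R]_n,
    [/\ zk @ \oo --> z,
        forall k, differentiable h (zk k) &
        ('J h (zk k))^T @[k --> \oo] --> V]].

Definition locally_lipschitz (R : realType) (n q : nat)
    (h : 'rV[R]_n -> 'rV[R]_q) : Prop :=
  forall z : 'rV[R]_n, exists k : R, exists2 U, nbhs z U & k.-lipschitz_U h.

Definition absolutely_continuous (R : realType) (n : nat) (a b : R)
    (g : R -> 'rV[R]_n) : Prop :=
  forall e : R, 0 < e -> exists2 d : R, 0 < d &
    forall (m : nat) (s t : 'I_m -> R),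
      (forall i, a <= s i /\ s i <= t i /\ t i <= b) ->
      trivIset [set: 'I_m] (fun i => `]s i, t i[%classic) ->
      \sum_(i < m) (t i - s i) < d ->
      \sum_(i < m) `|g (t i) - g (s i)| < e.

(* Curves on [0, 1] are total functions on R; only their values on [0, 1]
   matter, since the endpoints form a null set and the two-sided derivative at
   an interior point is local. *)
Definition conservative_jacobian (R : realType) (n q : nat)
    (h : 'rV[R]_n -> 'rV[R]_q) (J : 'rV[R]_n -> set 'M[R]_(q, n)) : Prop :=
  [/\ closed [set p : 'rV[R]_n * 'M[R]_(q, n) | J p.1 p.2],
      forall z : 'rV[R]_n, exists2 U, nbhs z U & bounded_set (\bigcup_(y in U) J y),
      forall z, J z !=set0 &
      forall g : R -> 'rV[R]_n, absolutely_continuous 0 1 g ->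
        {ae lebesgue_measure, forall t : R, `[0, 1]%classic t ->
          [/\ derivable g t 1, derivable (h \o g) t 1 &
              forall V, J (g t) V -> derive1 (h \o g) t = derive1 g t *m V^T]}].

Definition path_differentiable (R : realType) (n q : nat)
    (h : 'rV[R]_n -> 'rV[R]_q) : Prop :=
  locally_lipschitz h /\ exists J, conservative_jacobian h J.

Definition gradient (R : realType) (n : nat) (f : 'rV[R]_n -> R)
    (z : 'rV[R]_n) : 'rV[R]_n :=
  \row_(j < n) 'D_(delta_mx 0 j) f z.

Definition heavy_ball (R : realType) (alpha beta : R) (f : 'rV[R]_2 -> R)
    (x y theta : R) : 'rV[R]_2 :=
  rv2 (x - alpha * gradient f (rv2 x theta) 0 0 + beta * (x - y)) x.

(* Main.v *)
(* Convergence. The Heavy-Ball map sends (x, y) to (3/4 (x - y) + 3/4 min(x, 0), x);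
   it is positively homogeneous and continuous, and it maps a certain convex
   heptagon around 0 into 99/100 of itself.

   Path differentiability. At a time t where the first coordinate X of the curve
   is differentiable, the chain rule for the piecewise linear gradient can only
   fail if X(t) = 0 and X'(t) <> 0; such t are isolated zeros of X, hence
   countably many. What remains is that an absolutely continuous curve is
   differentiable almost everywhere. This follows Austin's argument for
   functions of bounded variation: if f has both slopes below -c and slopes
   above c at all scales around each point of A, then on every piece of a
   partition a Vitali cover by intervals going against the increment of f over
   that piece makes the variation exceed the increment by 2c|A|, so refining
   the partition gives |A| = 0. Subtracting linear functions with rational
   slopes shows that the difference quotients oscillate at almost no point.

   Clarke Jacobian. The Heavy-Ball map is not differentiable on the line x = 0
   and has Jacobian M1 for x < 0 and M2 for x > 0. *)
From HB Require Import structures.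
Require Import Defs.
From mathcomp Require Import ring lra.

Set Implicit Arguments.
Unset Strict Implicit.

Local Open Scope classical_set_scope.
Local Open Scope ring_scope.

(** * Outer measure, total variation and Vitali covers *)

Section differentiation.
Context {R : realType}.
Notation mu := (@lebesgue_measure R).
Notation TV := (@total_variation R).
Notation BV := (@bounded_variation R).
Implicit Types (f : R -> R) (A : set R) (a b c x : R).

(* [lebesgue_measure] applied to an arbitrary set is the outer measure. *)
Lemma lebesgue_outer_le A B : A `<=` B -> (mu A <= mu B)%E.
Proof. by move=> AB; exact: (@le_outer_measure _ _ (wlength idfun)^*%mu A B AB). Qed.

Lemma lebesgue_outerU A B : (mu (A `|` B) <= mu A + mu B)%E.
Proof. exact: (@outer_measureU2 _ _ (wlength idfun)^*%mu A B). Qed.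

(** [A] need not be measurable: a G-delta hull of equal outer measure serves as the measurable null
    set. *)
Lemma outer_measure_le0_negligible A :
  (forall e : R, 0 < e -> (mu A <= e%:E)%E) -> mu.-negligible A.
Proof.
move=> Ae; have [G [oG AG GA]] := outer_measure_Gdelta A.
exists (\bigcap_i G i); split => //.
  by apply: bigcap_measurableType => k _; exact: measurable_realfun.open_measurable.
rewrite GA; apply/eqP; rewrite eq_le outer_measure_ge0 andbT.
by apply/lee_addgt0Pr => e e0; rewrite add0e; exact: Ae.
Qed.

(** The intervals and the gaps between them partition [[a, b]]; by the triangle inequality the gaps
    contribute at least the absolute value of their total increment. The list is unsorted: its head
    separates the other intervals into those on its left ([L]) and those on its right ([L']), both
    shorter lists, hence the induction on a bound for the size. *)
Lemma total_variation_disjoint f (l : seq (R * R)) a b : a <= b ->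
  {in l, forall p, [/\ a <= p.1, p.1 <= p.2 & p.2 <= b]} ->
  pairwise (fun p q : R * R => (p.2 <= q.1) || (q.2 <= p.1)) l ->
  ((\sum_(p <- l) `|f p.2 - f p.1| +
    `|f b - f a - \sum_(p <- l) (f p.2 - f p.1)|)%:E <= TV a b f)%E.
Proof.
move: {2}(size l) (leqnn (size l)) => n.
elim: n l a b => [|n IH] [|[u v] l] a b //= sl ab lab.
- by rewrite !big_nil add0r subr0 => _; exact: total_variation_ge.
- by rewrite !big_nil add0r subr0 => _; exact: total_variation_ge.
move=> /andP[uvl pl].
have /= [au uv vb] : [/\ a <= u, u <= v & v <= b].
  by have := lab (u, v); rewrite mem_head => /(_ isT).
pose L := [seq p <- l | p.2 <= u]; pose L' := [seq p <- l | ~~ (p.2 <= u)].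
have sub p : p \in l -> [/\ a <= p.1, p.1 <= p.2 & p.2 <= b].
  by move=> pl'; apply: lab; rewrite inE pl' orbT.
have szL : (size L <= n)%N by rewrite size_filter (leq_trans (count_size _ _)).
have szL' : (size L' <= n)%N by rewrite size_filter (leq_trans (count_size _ _)).
have := IH L a u szL au.
have := IH L' v b szL' vb.
move=> H1 H2; rewrite (total_variationD f au (le_trans uv vb)).
rewrite (total_variationD f uv vb).
have {}H2 := H2 _ (subseq_pairwise (filter_subseq _ _) pl).
have {}H1 := H1 _ (subseq_pairwise (filter_subseq _ _) pl).
have {}H2 : ((\sum_(p <- L) `|f p.2 - f p.1| +
    `|f u - f a - \sum_(p <- L) (f p.2 - f p.1)|)%:E <= TV a u f)%E.
  by apply: H2 => p; rewrite mem_filter => /andP[pu /sub[]].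
have {}H1 : ((\sum_(p <- L') `|f p.2 - f p.1| +
    `|f b - f v - \sum_(p <- L') (f p.2 - f p.1)|)%:E <= TV v b f)%E.
  apply: H1 => p; rewrite mem_filter => /andP[pu pl']; have [] := sub _ pl'.
  move=> ? ? ?; split => //.
  by move/allP: uvl => /(_ _ pl')/=; rewrite (negbTE pu) orbF.
apply: (le_trans _ (leeD H2 (leeD (total_variation_ge f uv) H1))).
have split (F : R * R -> R) :
    \sum_(p <- l) F p = \sum_(p <- L) F p + \sum_(p <- L') F p.
  by rewrite (bigID (fun p => p.2 <= u))/= !big_filter.
rewrite -!EFinD lee_fin !big_cons/= !split.
set S := \sum_(p <- L) (_ - _); set S' := \sum_(p <- L') (_ - _).
have -> : f b - f a - (f v - f u + (S + S')) =
          (f u - f a - S) + (f b - f v - S') by ring.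
have := ler_normD (f u - f a - S) (f b - f v - S'). lra.
Qed.

(** Balls with rational centre and radius, enumerated by [nat]. The default radius 1 keeps every
    ball of the family nondegenerate, also for codes of no use, as the Vitali theorem is applied
    with all radii positive. *)
Let ctr (k : nat) : R := ratr (odflt (0, 0) (unpickle k : option (rat * rat))).1.
Let rad (k : nat) : R :=
  let r := (odflt (0, 1) (unpickle k : option (rat * rat))).2 in
  if 0 < r then ratr r else 1.

Let rad_gt0 k : 0 < rad k.
Proof. by rewrite /rad; case: ifPn => // r0; rewrite ltr0q. Qed.

(** Since [W] survives small moves of both endpoints, each good interval can be replaced by a
    rational one, which reduces the cover to a countable family. *)
Lemma vitali_intervals A (W : R -> R -> Prop) a b : A `<=` `]a, b[ ->
  (forall x, A x -> forall e : R, 0 < e -> exists u v, [/\ u < x < v, v - u < e &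
     exists2 d : R, 0 < d & forall u' v', `|u' - u| < d -> `|v' - v| < d -> W u' v']) ->
  forall e : R, 0 < e -> exists l : seq (R * R),
    [/\ {in l, forall p, [/\ a <= p.1, p.1 <= p.2, p.2 <= b & W p.1 p.2]},
        pairwise (fun p q : R * R => (p.2 <= q.1) || (q.2 <= p.1)) l &
        (mu A <= (\sum_(p <- l) (p.2 - p.1) + e)%:E)%E].
Proof.
move=> Aab AW e e0.
pose B k : set R := ball (ctr k) (rad k).
have radB k : (radius (B k))%:num = rad k.
  by rewrite /B radius_ball_num// ltW.
have B0 k : 0 < (radius (B k))%:num by rewrite radB.
pose F : set nat := [set k | [/\ a <= ctr k - rad k, ctr k + rad k <= b &
                                W (ctr k - rad k) (ctr k + rad k)]].
have ABF : vitali_cover A B F.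
  split=> [i|x Ax r r0]; first exact: is_ball_ball.
  have /= := Aab _ Ax; rewrite in_itv/= => /andP[ax xb].
  have e'0 : 0 < Num.min r (Num.min (x - a) (b - x)) by rewrite !lt_min r0 !subr_gt0 ax.
  have [u [v [/andP[ux xv] + [d d0 dW]]]] := AW _ Ax _ e'0.
  rewrite !lt_min => /and3P[vur vua vub].
  (* Centre and radius are each rounded by less than [d' / 2], so the endpoints move by less than
     [d']. The terms of the minimum preserve, in order, [W], the membership of [x], the inclusion in
     []a, b[], the length bound and the positivity of the radius. *)
  pose d' := Num.min (d / 2) (Num.min (Num.min ((x - u) / 2) ((v - x) / 2))
       (Num.min (Num.min ((u - a) / 2) ((b - v) / 2)) (Num.min ((r - (v - u)) / 2) ((v - u) / 2)))).
  have d'0 : 0 < d' by rewrite !lt_min; apply/andP; split; [|repeat (apply/andP; split)]; lra.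
  have [d1 d2 d3 d4 d5] : [/\ d' <= d / 2, d' <= (x - u) / 2 , d' <= (v - x) / 2,
       d' <= (u - a) / 2 & d' <= (b - v) / 2].
    by rewrite /d' !ge_min !lexx !orbT.
  have [d6 d7] : d' <= (r - (v - u)) / 2 /\ d' <= (v - u) / 2.
    by rewrite /d' !ge_min !lexx !orbT.
  have [q1] := @rat_in_itvoo R ((u + v) / 2 - d' / 2) ((u + v) / 2 + d' / 2) ltac:(lra).
  rewrite in_itv/= => /andP[q1l q1r].
  have [q2] := @rat_in_itvoo R ((v - u) / 2 - d' / 2) ((v - u) / 2 + d' / 2) ltac:(lra).
  rewrite in_itv/= => /andP[q2l q2r].
  have q20 : (0 : R) < ratr q2 by lra.
  have Ec : ctr (pickle (q1, q2)) = ratr q1 by rewrite /ctr pickleK.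
  have Er : rad (pickle (q1, q2)) = ratr q2.
    by rewrite /rad pickleK/= -(ltr0q R) q20.
  exists (pickle (q1, q2)); split.
  - rewrite /F/= Ec Er; split; [lra|lra|].
    by apply: dW; rewrite ltr_norml; apply/andP; split; lra.
  - by rewrite /B Ec Er /ball/= ltr_norml; apply/andP; split; lra.
  - by rewrite radB Er; lra.
have muA : (mu A < +oo)%E.
  have : (mu `]a, b[ < +oo)%E.
    by rewrite lebesgue_measure_itv/=; case: ifP => _; rewrite ?ltry// -EFinB ltry.
  apply: le_lt_trans; exact: le_outer_measure.
have [G [GF tG AGe]] := vitali_theorem_corollary B0 muA ABF e0.
have cB k : closure (B k) = `[ctr k - rad k, ctr k + rad k]%classic.
  by rewrite closure_ballE closed_ball_itv.
exists [seq (ctr k - rad k, ctr k + rad k) | k <- finmap.enum_fset G]; split.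
- move=> p /mapP[k kG ->]/=; have [] := GF k kG => ? ? ?; split => //.
  have := rad_gt0 k; lra.
- rewrite pairwise_map.
  apply: (@sub_in_pairwise _ (fun i => i \in finmap.enum_fset G) (fun i j => i != j)); last first.
  + by rewrite -uniq_pairwise finmap.fset_uniq.
  + by apply/allP.
  move=> i j iG jG ij /=.
  move/trivIsetP: tG => /(_ i j iG jG ij)/=; rewrite !cB => /seteqP[+ _].
  (* If two closed balls overlapped, the larger of their left endpoints would lie in both. *)
  move=> /(_ (Num.max (ctr i - rad i) (ctr j - rad j)))/= disj.
  have := rad_gt0 i; have := rad_gt0 j => ri rj.
  rewrite !leNgt -negb_and; apply/negP => /andP[ij1 ij2]; apply: disj.
  rewrite !in_itv/= !le_max !ge_max !lexx !orbT/=.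
  by split; apply/andP; split; lra.
- move: AGe; set U := \big[setU/set0]_(k <- finmap.enum_fset G) closure (B k) => AGe.
  have AU : A `<=` (A `\` U) `|` U.
    by move=> x Ax; have [Ux|Ux] := pselect (U x); [right|left].
  apply: (le_trans (lebesgue_outer_le AU)).
  apply: (le_trans (lebesgue_outerU _ _)).
  rewrite addrC EFinD leeD// ?(ltW AGe)// big_map.
  rewrite /U; elim: (finmap.enum_fset G) => [|k s IHs].
    by rewrite !big_nil measure0.
  rewrite !big_cons; apply: (le_trans (lebesgue_outerU _ _)).
  rewrite EFinD leeD// cB lebesgue_measure_itv/=.
  by case: ifP => _; rewrite ?lee_fin -?EFinB//; have := rad_gt0 k; lra.
Qed.

(** * Almost everywhere differentiability of functions of bounded variation *)

(* At y = x the quotient is 0 / 0 = 0, so for c >= 0 only points y <> x qualify. *)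
Definition steep_drop f c x : Prop :=
  forall e, 0 < e -> exists2 y, `|y - x| < e & (f y - f x) / (y - x) < - c.

Lemma drop_interval_open f c u v : 0 < c ->
  {for u, continuous f} -> {for v, continuous f} ->
  f v - f u < - (c * (v - u)) ->
  exists2 d : R, 0 < d & forall u' v', `|u' - u| < d -> `|v' - v| < d ->
    f v' - f u' < - (c * (v' - u')).
Proof.
move=> c0 fu fv W; pose D := - (c * (v - u)) - (f v - f u).
(* The slack [D] is shared by four errors: the changes of [f] at both ends, and [c] times the
   displacement of each end. *)
have D0 : 0 < D / 4 by rewrite /D; lra.
have /cvgrPdist_lt/(_ _ D0)/nbhs_ballP[d1 /= d10 H1] := fu.
have /cvgrPdist_lt/(_ _ D0)/nbhs_ballP[d2 /= d20 H2] := fv.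
have Dc0 : 0 < D / 4 / c by rewrite divr_gt0.
exists (Num.min (D / 4 / c) (Num.min d1 d2)); first by rewrite !lt_min d10 d20 Dc0.
move=> u' v'; rewrite !lt_min => /and3P[uD u1 u2] /and3P[vD v1 v2].
have := H1 u'; rewrite /ball/= distrC => /(_ u1).
have := H2 v'; rewrite /ball/= distrC => /(_ v2).
move: uD vD; rewrite !(ltr_pdivlMr _ _ c0).
have E t : `|t| * c = `|c * t| by rewrite normrM (gtr0_norm c0) mulrC.
rewrite !E !ltr_norml /D => /andP[? ?] /andP[? ?] /andP[? ?] /andP[? ?]; lra.
Qed.

(** A steep drop at [x] gives an interval with [x] as an endpoint, whereas the Vitali cover needs
    [x] inside. Openness of the drop condition allows the interval to be prolonged by a small [s]
    beyond [x]. *)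
Lemma steep_drop_intervals f A a b c : 0 < c ->
  (forall x, a < x < b -> {for x, continuous f}) ->
  A `<=` `]a, b[ -> (forall x, A x -> steep_drop f c x) ->
  forall e : R, 0 < e -> exists l : seq (R * R),
    [/\ {in l, forall p, [/\ a <= p.1, p.1 <= p.2, p.2 <= b &
                             f p.2 - f p.1 <= - (c * (p.2 - p.1))]},
        pairwise (fun p q : R * R => (p.2 <= q.1) || (q.2 <= p.1)) l &
        (mu A <= (\sum_(p <- l) (p.2 - p.1) + e)%:E)%E].
Proof.
move=> c0 cf Aab Af e e0.
have [|l [H1 H2 H3]] := @vitali_intervals A
    (fun u v => f v - f u < - (c * (v - u))) a b Aab _ e e0; last first.
  by exists l; split => // p /H1[? ? ? /ltW ?]; split.
move=> x Ax r r0.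
have /= := Aab _ Ax; rewrite in_itv/= => /andP[ax xb].
have r'0 : 0 < Num.min (r / 2) (Num.min (x - a) (b - x)).
  by rewrite !lt_min !subr_gt0 ax xb divr_gt0.
have [y] := Af _ Ax _ r'0; rewrite !lt_min => /and3P[+ + +] fyx.
rewrite !ltr_norml => /andP[y1 y2] /andP[y3 y4] /andP[y5 y6].
have fx : {for x, continuous f} by apply: cf; rewrite ax.
have fy : {for y, continuous f} by apply: cf; lra.
have Wo u v : a < u < b -> a < v < b -> f v - f u < - (c * (v - u)) ->
   exists2 d : R, 0 < d & forall u' v', `|u' - u| < d -> `|v' - v| < d ->
    f v' - f u' < - (c * (v' - u')).
  by move=> /cf ? /cf ?; exact: drop_interval_open.
have [xy|yx|xy] := ltgtP x y; last by rewrite xy !subrr mul0r in fyx; lra.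
- move: fyx; rewrite ltr_pdivrMr ?subr_gt0// mulNr => fyx.
  have [||d d0 dW] := Wo x y _ _ fyx; [lra|lra|].
  pose s := Num.min (d / 2) (Num.min (r / 2) ((x - a) / 2)).
  have s0 : 0 < s by rewrite !lt_min !divr_gt0// subr_gt0.
  have [s1 s2 s3] : [/\ s <= d / 2, s <= r / 2 & s <= (x - a) / 2].
    by rewrite /s !ge_min !lexx !orbT.
  exists (x - s), y; split; [lra|lra|].
  apply: Wo; [lra|lra|apply: dW]; rewrite ltr_norml; lra.
- have {}fyx : f x - f y < - (c * (x - y)).
    move: fyx; rewrite ltr_ndivrMr ?subr_lt0// mulNr; lra.
  have [||d d0 dW] := Wo y x _ _ fyx; [lra|lra|].
  pose s := Num.min (d / 2) (Num.min (r / 2) ((b - x) / 2)).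
  have s0 : 0 < s by rewrite !lt_min !divr_gt0// subr_gt0.
  have [s1 s2 s3] : [/\ s <= d / 2, s <= r / 2 & s <= (b - x) / 2].
    by rewrite /s !ge_min !lexx !orbT.
  exists y, (x + s); split; [lra|lra|].
  apply: Wo; [lra|lra|apply: dW]; rewrite ltr_norml; lra.
Qed.

(** Disjoint intervals of total length [S] on which [f] drops at rate [c] have variation at least
    [c * S]. The rest of [[a, b]] must recover that drop and still produce [f b - f a], which costs
    another [c * S + (f b - f a)]. *)
Lemma steep_drop_total_variation f A a b c : 0 < c -> a <= b ->
  (forall x, a < x < b -> {for x, continuous f}) ->
  A `<=` `]a, b[ -> (forall x, A x -> steep_drop f c x) ->
  (c%:E * mu A <= TV a b f)%E /\
  (f a <= f b -> ((2 * c)%:E * mu A + (f b - f a)%:E <= TV a b f)%E).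
Proof.
move=> c0 ab cf Aab Af.
have H (e : R) : 0 < e -> exists2 S : R, (mu A <= (S + e)%:E)%E &
    ((c * S)%:E <= TV a b f)%E /\
    (f a <= f b -> ((2 * c * S + (f b - f a))%:E <= TV a b f)%E).
  move=> e0; have [l [l1 l2 l3]] := steep_drop_intervals c0 cf Aab Af e0.
  exists (\sum_(p <- l) (p.2 - p.1)) => //.
  have {}l2 := @total_variation_disjoint f l a b ab _ l2.
  have {}l2 := l2 (fun p pl => let: And4 h1 h2 h3 _ := l1 p pl in And3 h1 h2 h3).
  have : \sum_(p <- l) (f p.2 - f p.1) <= - (c * \sum_(p <- l) (p.2 - p.1)).
    by rewrite mulr_sumr -sumrN 2!big_seq ler_sum// => p /l1[].
  have : - \sum_(p <- l) (f p.2 - f p.1) <= \sum_(p <- l) `|f p.2 - f p.1|.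
    by rewrite -sumrN ler_sum// => p _; rewrite -normrN ler_norm.
  move: l2.
  set S1 := \sum_(p <- l) `|_|; set S2 := \sum_(p <- l) (_ - _).
  set S := \sum_(p <- l) _; move=> l2 S12 S2S.
  have := normr_ge0 (f b - f a - S2); have := ler_norm (f b - f a - S2).
  move=> n1 n2.
  by split=> [|fab]; apply: (le_trans _ l2); rewrite lee_fin; lra.
have c'0 : 0 < c^-1 by rewrite invr_gt0.
split=> [|fab]; apply/lee_addgt0Pr => e e0.
- have [S AS [S1 _]] := H (c^-1 * e) ltac:(by rewrite mulr_gt0).
  apply: (@le_trans _ _ (c%:E * (S + c^-1 * e)%:E)%E).
    by rewrite lee_pmul2l.
  rewrite -EFinM mulrDr mulrA divff ?gt_eqF// mul1r EFinD leeD//.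
- have [S AS [_ /(_ fab) S1]] := H ((2 * c)^-1 * e)
    ltac:(by rewrite mulr_gt0// invr_gt0 mulr_gt0).
  apply: (@le_trans _ _ ((2 * c)%:E * (S + (2 * c)^-1 * e)%:E + (f b - f a)%:E)%E).
    by rewrite leeD// lee_pmul2l// lte_fin mulr_gt0.
  rewrite -EFinM mulrDr mulrA divff ?gt_eqF ?mulr_gt0// mul1r -EFinD addrAC EFinD.
  by rewrite leeD.
Qed.

(** The previous bound is summed over the pieces of the partition, applied to [f] where the piece
    has a nonnegative increment and to [\- f] elsewhere; this is why drops of both are assumed.
    Partition points form a null set. *)
Lemma steep_drop_variation f A a b c s : 0 < c ->
  (forall x, a < x < b -> {for x, continuous f}) ->
  A `<=` `]a, b[ ->
  (forall x, A x -> steep_drop f c x /\ steep_drop (\- f) c x) ->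
  itv_partition a b s ->
  ((2 * c)%:E * mu A + (variation a b f s)%:E <= TV a b f)%E.
Proof.
move=> c0; elim: s a A => [|y s IH] a A cf Aab Af abs.
  have /eqP ab : a == b by case: abs.
  have -> : A = set0 by apply/seteqP; split => // x /Aab; rewrite /= in_itv/= ab; lra.
  rewrite measure0 mule0 add0e /variation big_nil; apply: total_variation_ge0.
  by rewrite ab.
have ay : a < y by case: abs => /= /andP[].
have ybs : itv_partition y b s by exact: itv_partition_cons abs.
have yb : y <= b by exact: itv_partition_le ybs.
have -> : variation a b f (y :: s) = `|f y - f a| + variation y b f s.
  by rewrite /variation/= big_nat_recl.
rewrite (total_variationD f (ltW ay) yb).
pose A1 := A `&` `]a, y[; pose A2 := A `&` `]y, b[.
have mA : (mu A <= mu A1 + mu A2)%E.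
  have : A `<=` A1 `|` (A2 `|` [set y]).
    move=> x Ax; have := Aab _ Ax; rewrite /= in_itv/= => /andP[ax xb].
    have [xy|xy|xy] := ltgtP x y.
    + by left; split => //=; rewrite in_itv/= ax.
    + by right; left; split => //=; rewrite in_itv/= xy.
    + by right; right.
  move=> /lebesgue_outer_le/le_trans; apply.
  apply: (le_trans (lebesgue_outerU _ _)); rewrite leeD2l//.
  apply: (le_trans (lebesgue_outerU _ _)).
  by rewrite lebesgue_measure_set1 adde0.
have H2 := IH y A2 _ _ _ ybs.
have {}H2 : ((2 * c)%:E * mu A2 + (variation y b f s)%:E <= TV y b f)%E.
  apply: H2.
  - by move=> x /andP[yx xb]; apply: cf; rewrite xb (lt_trans ay).
  - by move=> x [].
  - by move=> x [/Af].
have H1 : ((2 * c)%:E * mu A1 + `|f y - f a|%:E <= TV a y f)%E.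
  have cf1 : forall x, a < x < y -> {for x, continuous f}.
    by move=> x /andP[ax xy]; apply: cf; rewrite ax (lt_le_trans xy).
  have A1a : A1 `<=` `]a, y[ by move=> x [].
  have [fay|fay] := leP (f a) (f y).
    rewrite ger0_norm ?subr_ge0//.
    by apply: (steep_drop_total_variation c0 (ltW ay) cf1 A1a _).2 => // x [/Af[]].
  rewrite ltr0_norm ?subr_lt0// -total_variationN.
  rewrite (_ : - (f y - f a) = (\- f) y - (\- f) a); last by rewrite /= opprB opprK addrC.
  apply: (steep_drop_total_variation c0 (ltW ay) _ A1a _).2.
  - by move=> x /cf1 fx; apply: cvgN.
  - by move=> x [/Af[]].
  - by rewrite /= lerN2 ltW.
apply: (le_trans _ (leeD H1 H2)).
rewrite addeACA -ge0_muleDr ?measure_ge0// -EFinD leeD// lee_pmul2l// lte_fin.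
by rewrite mulr_gt0.
Qed.

(** A partition whose variation is within [2 * c * e] of the total variation leaves room for an
    outer measure of at most [e]. *)
Lemma steep_drop_oscillation_negligible f a b c : 0 < c -> a < b ->
  (forall x, a < x < b -> {for x, continuous f}) -> BV a b f ->
  mu.-negligible [set x | [/\ a < x < b, steep_drop f c x & steep_drop (\- f) c x]].
Proof.
move=> c0 ab cf bvf; apply: outer_measure_le0_negligible => e e0.
set A := [set x | _].
have c20 : 0 < 2 * c by rewrite mulr_gt0.
have /bounded_variationP := bvf; move=> /(_ (ltW ab)) TVfin.
have : (0 < (2 * c * e)%:E)%E by rewrite lte_fin mulr_gt0.
move=> /ub_ereal_sup_adherent/(_ TVfin)[_ [_ [s abs <-] <-] TVs].
have : ((2 * c)%:E * mu A + (variation a b f s)%:E <= TV a b f)%E.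
  apply: steep_drop_variation => //.
  - by move=> x [+ _ _]; rewrite /= in_itv.
  - by move=> x [].
move: TVs; rewrite -/(TV a b f) -(fineK TVfin) -EFinB lte_fin => TVs H.
rewrite -(@lee_pmul2l _ (2 * c)%:E)//.
rewrite -(@leeD2rE _ (variation a b f s)%:E)//.
apply: (le_trans H).
by rewrite -EFinM -EFinD lee_fin; lra.
Qed.

(** A Chebyshev-type bound: drops at rate [n.+1] on [A] force [n.+1 * mu A] below the total
    variation, for arbitrarily large [n]. *)
Lemma steep_drop_unbounded_negligible f a b : a < b ->
  (forall x, a < x < b -> {for x, continuous f}) -> BV a b f ->
  mu.-negligible [set x | a < x < b /\ forall n : nat, steep_drop f n.+1%:R x].
Proof.
move=> ab cf bvf; apply: outer_measure_le0_negligible => e e0.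
set A := [set x | _].
have /bounded_variationP := bvf; move=> /(_ (ltW ab)) TVfin.
pose V := fine (TV a b f).
pose n := Num.truncn (V / e).
have n0 : 0 < n.+1%:R :> R by rewrite ltr0n.
have [||H _] := @steep_drop_total_variation f A a b n.+1%:R n0 (ltW ab) cf.
- by move=> x [+ _]; rewrite /= in_itv.
- by move=> x [].
rewrite -(@lee_pmul2l _ n.+1%:R%:E)// ?lte_fin//.
apply: (le_trans H); rewrite -(fineK TVfin) -EFinM lee_fin -/V.
by rewrite -ler_pdivrMr// ltW// truncnS_gt.
Qed.

Lemma not_steep_drop f c x : ~ steep_drop f c x ->
  \forall y \near x, - c <= (f y - f x) / (y - x).
Proof.
move=> /existsNP[e /not_implyP[e0 /forall2NP H]]; apply/nbhs_ballP.
exists e => //= y; rewrite /ball/= distrC => yx.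
by case: (H y) => // /negP; rewrite -leNgt.
Qed.

Lemma not_steep_rise f c x : ~ steep_drop (\- f) c x ->
  \forall y \near x, (f y - f x) / (y - x) <= c.
Proof.
move=> /not_steep_drop; apply: filterS => y.
by rewrite /= -opprD mulNr lerN2.
Qed.

(** The first two hypotheses bound the difference quotient [q], so its lower limit [sup E] is
    finite. Were the upper limit larger, subtracting a linear function with a rational slope
    strictly between them would leave slopes of both signs bounded away from 0. *)
Lemma steep_drop_derivable f x :
  ~ (forall n : nat, steep_drop f n.+1%:R x) ->
  ~ (forall n : nat, steep_drop (\- f) n.+1%:R x) ->
  (forall (m : rat) (n : nat), ~ (steep_drop (fun t => f t - ratr m * t) n.+1%:R^-1 x /\
     steep_drop (\- (fun t => f t - ratr m * t)) n.+1%:R^-1 x)) ->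
  derivable f x 1.
Proof.
move=> /existsNP[n1 /not_steep_drop H1] /existsNP[n2 /not_steep_rise H2] H3.
pose q y := (f y - f x) / (y - x).
pose E : set R := [set p : R | \forall y \near x^', p <= q y].
have En1 : E (- n1.+1%:R) by apply: nbhs_dnbhs; exact: H1.
have Eub : ubound E n2.+1%:R.
  move=> p Ep; have H2' : \forall y \near x^', q y <= n2.+1%:R.
    by apply: nbhs_dnbhs; exact: H2.
  have : \forall y \near x^', p <= n2.+1%:R.
    by apply: filterS2 Ep H2' => y; exact: le_trans.
  by move=> /filter_ex[].
have supE : has_sup E by split; [exists (- n1.+1%:R)|exists n2.+1%:R].
have qL : q y @[y --> x^'] --> sup E.
  apply/cvgrPdist_le => e e0.
  have lo : \forall y \near x^', sup E - e <= q y.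
    have [p Ep pe] := sup_adherent e0 supE.
    by apply: filterS Ep => y; apply: le_trans; exact: ltW.
  have hi : \forall y \near x^', q y <= sup E + e.
    have [n] : exists n : nat, n.+1%:R^-1 < e / 4.
      exists (Num.truncn (e / 4)^-1).
      rewrite invf_plt ?posrE ?ltr0n//; last by rewrite divr_gt0.
      by rewrite truncnS_gt.
    set c := n.+1%:R^-1 => ce.
    have c0 : 0 < c by rewrite invr_gt0 ltr0n.
    (* With this [m], absence of steep drops would put [ratr m - c], which exceeds [sup E], into
       [E]; absence of steep rises gives [q y <= ratr m + c], below [sup E + 3 * c] and hence below
       [sup E + e]. *)
    have [m] := @rat_in_itvoo R (sup E + c) (sup E + 2 * c) ltac:(lra).
    rewrite in_itv/= => /andP[mE mE2].
    have qm y : y != x -> (f y - ratr m * y - (f x - ratr m * x)) / (y - x) = q y - ratr m.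
      by move=> yx; rewrite /q; field; rewrite subr_eq0.
    have /not_andP[] := H3 m n; rewrite -/c.
    - move=> /not_steep_drop/nbhs_dnbhs H.
      have : E (ratr m - c).
        rewrite /E/=; near=> y.
        have yx : y != x by near: y; exact: nbhs_dnbhs_neq.
        suff : - c <= q y - ratr m by lra.
        by rewrite -qm//; near: y; exact: H.
      move=> /(ub_le_sup supE.2); lra.
    - move=> /not_steep_rise/nbhs_dnbhs H.
      near=> y.
      have yx : y != x by near: y; exact: nbhs_dnbhs_neq.
      suff : q y - ratr m <= c by lra.
      by rewrite -qm//; near: y; exact: H.
  by apply: filterS2 lo hi => y l h; rewrite ler_norml; lra.
apply/cvg_ex; exists (sup E).
apply/cvgrPdist_le => e e0.
move/cvgrPdist_le: qL => /(_ _ e0).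
rewrite /dnbhs !near_withinE => /nbhs_ballP[d /= d0 H].
apply/nbhs_ballP; exists d => // h; rewrite /ball/= sub0r normrN => hd h0.
have := H (h + x); rewrite /ball/= opprD addrCA subrr addr0 normrN => /(_ hd).
rewrite -subr_eq0 addrK => /(_ h0); rewrite /q addrK.
by rewrite /GRing.scale/= mulr1 (mulrC h^-1).
Unshelve. all: by end_near. Qed.

Lemma bounded_variation_ae_derivable f a b : a < b ->
  (forall x, a < x < b -> {for x, continuous f}) -> BV a b f ->
  {ae mu, forall x, a < x < b -> derivable f x 1}.
Proof.
move=> ab cf bvf.
have cNf x : a < x < b -> {for x, continuous (\- f)}.
  by move=> /cf fx; exact: cvgN.
have bvNf := bounded_variationN bvf.
pose g (m : rat) : R -> R := fun t => f t - ratr m * t.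
have cg m x : a < x < b -> {for x, continuous (g m)}.
  by move=> /cf fx; apply: cvgB => //; apply: cvgMr; exact: cvg_id.
have bvg m : BV a b (g m).
  apply: (bounded_variationD ab bvf).
  have [m0|m0] := leP 0 m.
    rewrite (_ : (fun _ => _) = \- (fun t : R => ratr m * t))//.
    apply/bounded_variationN/nondecreasing_bounded_variation => x y _ _ xy.
    by rewrite ler_wpM2l// ler0q.
  apply: nondecreasing_bounded_variation => x y _ _ xy.
  by rewrite lerN2 ler_wnM2l// ltW// ltrq0.
pose B (k : nat) : set R :=
  let m := (odflt (0, 0%N) (unpickle k : option (rat * nat))).1 in
  let n := (odflt (0, 0%N) (unpickle k : option (rat * nat))).2 in
  [set x | [/\ a < x < b, steep_drop (g m) n.+1%:R^-1 x & steep_drop (\- g m) n.+1%:R^-1 x]].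
have N3 : mu.-negligible (\bigcup_k B k).
  apply: negligible_bigcup => k.
  by apply: steep_drop_oscillation_negligible => //; exact: cg.
have N1 := steep_drop_unbounded_negligible ab cf bvf.
have N2 := steep_drop_unbounded_negligible ab cNf bvNf.
apply: negligibleS (negligibleU N1 (negligibleU N2 N3)) => x /= /not_implyP[xab ndf].
apply: contrapT => /not_orP[n1 /not_orP[n2 n3]]; apply: ndf.
apply: steep_drop_derivable.
- by move=> H; apply: n1.
- by move=> H; apply: n2.
- move=> m n [H1 H2]; apply: n3; exists (pickle (m, n)) => //.
  by rewrite /B pickleK/=.
Qed.

(** * Absolutely continuous curves *)

Lemma ler_mx_entry m n (M : 'M[R]_(m, n)) i j : `|M i j| <= `|M|.
Proof.
rewrite [leRHS]/Num.norm/= mx_normrE.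
exact: (le_bigmax _ (fun ij : 'I_m * 'I_n => `|M ij.1 ij.2|) (i, j)).
Qed.

Lemma mx_norm_le m n (M : 'M[R]_(m, n)) (K : R) : 0 <= K ->
  (forall i j, `|M i j| <= K) -> `|M| <= K.
Proof.
move=> K0 MK; rewrite [leLHS]/Num.norm/= mx_normrE.
by apply: bigmax_le => // -[i j] _; exact: MK.
Qed.

Lemma absolutely_continuous_continuous n a b (g : R -> 'rV[R]_n) t :
  absolutely_continuous a b g -> a < t < b -> {for t, continuous g}.
Proof.
move=> acg /andP[at_ tb]; apply/cvgrPdist_lt => e e0.
have [d d0 H] := acg _ e0.
have H' u v : a <= u -> u <= v -> v <= b -> v - u < d -> `|g v - g u| < e.
  move=> au uv vb uvd.
  have := H 1%N (fun=> u) (fun=> v).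
  rewrite !big_ord1; apply => //.
  by move=> i j _ _ _; rewrite (ord1 i) (ord1 j).
have d'0 : 0 < Num.min d (Num.min (t - a) (b - t)).
  by rewrite !lt_min d0 !subr_gt0 at_.
apply/nbhs_ballP; exists (Num.min d (Num.min (t - a) (b - t))) => //= s.
rewrite /ball/= !lt_min !ltr_norml => /and3P[/andP[? ?] /andP[? ?] /andP[? ?]].
have [st|ts] := leP s t; first by apply: H'; lra.
by rewrite distrC; apply: H'; lra.
Qed.

(** Absolute continuity at tolerance 1 bounds the variation by 1 on every interval shorter than [d],
    and finitely many such intervals cover [[a, b]]. *)
Lemma absolutely_continuous_bounded_variation n a b (g : R -> 'rV[R]_n) i :
  a < b -> absolutely_continuous a b g -> BV a b (fun t => g t 0 i).
Proof.
move=> ab acg; have [d d0 H] := acg _ ltr01.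
set f := fun t => g t 0 i.
have small u v : a <= u -> u < v -> v <= b -> v - u < d -> BV u v f.
  move=> au uv vb uvd; exists 1 => _ [s uvs <-].
  pose F := nth v (u :: s).
  have Fu k : (k <= size s)%N -> u <= F k.
    by move=> ks; exact: itv_partition_nth_ge.
  have Fv k : F k <= v.
    have [ks|ks] := ltnP k (size s).+1; first exact: itv_partition_nth_le.
    by rewrite /F nth_default.
  have Fhomo k l : (k <= l <= size s)%N -> F k <= F l.
    case: uvs => us _ /andP[kl ls]; move: kl; rewrite leq_eqVlt => /predU1P[->//|kl].
    apply/ltW/(sorted_ltn_nth lt_trans) => //; rewrite ?inE//=.
    by rewrite ltnS (leq_trans (ltnW kl)).
  apply: (@le_trans _ _ (\sum_(k < size s) `|g (F k.+1) - g (F k)|)).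
    rewrite /variation big_mkord ler_sum// => k _ /=.
    by have := ler_mx_entry (g (F k.+1) - g (F k)) 0 i; rewrite !mxE.
  apply: ltW; apply: (H _ (fun k : 'I__ => F k) (fun k : 'I__ => F k.+1)).
  - move=> k; split; [|split].
    + by rewrite (le_trans au)// Fu// ltnW.
    + by rewrite Fhomo// leqnSn/=.
    + by rewrite (le_trans (Fv _)).
  - apply/trivIsetP => k l _ _.
    wlog kl : k l / (k < l)%N.
      move=> wlg; rewrite neq_ltn => /orP[kl|lk].
        by apply: wlg; rewrite // neq_ltn kl.
      by rewrite setIC; apply: wlg; rewrite // neq_ltn lk.
    move=> _; apply/seteqP; split => // x [] /=; rewrite !in_itv/=.
    have : F k.+1 <= F l by rewrite Fhomo// kl/= ltnW.
    by move=> ? /andP[_ ?] /andP[? _]; lra.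
  (* The lengths sum to [v - u], obtained as the variation of the identity. *)
  - have <- : variation u v idfun s = \sum_(k < size s) (F k.+1 - F k).
      rewrite /variation big_mkord; apply: eq_bigr => k _.
      by rewrite -[RHS]ger0_norm// subr_ge0 Fhomo// leqnSn/=.
    by rewrite nondecreasing_variation.
apply/bounded_variationP; first exact: ltW.
(* Steps of [d / 2] stay strictly below the admissible length [d]. *)
suff : forall (k : nat) u, a <= u -> u < b -> b - u < d / 2 * k.+1%:R ->
    TV u b f \is a fin_num.
  move/(_ (Num.truncn ((b - a) / (d / 2))) a (lexx _) ab); apply.
  by rewrite mulrC -ltr_pdivrMr ?truncnS_gt// divr_gt0.
elim => [|k IH] u au ub.
  rewrite mulr1 => bud; apply/bounded_variationP; first exact: ltW.
  apply: small => //; lra.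
have [bud _|dbu bud] := ltP (b - u) d.
  apply/bounded_variationP; first exact: ltW.
  exact: small.
rewrite (@total_variationD _ _ _ (u + d / 2)); [|lra|lra].
rewrite fin_numD; apply/andP; split.
  apply/bounded_variationP; first lra.
  by apply: small; lra.
apply: IH; [lra|lra|].
by move: bud; have -> : k.+2%:R = k.+1%:R + 1 :> R by [rewrite natr1]; lra.
Qed.

Lemma absolutely_continuous_ae_derivable n a b (g : R -> 'rV[R]_n) : a < b ->
  absolutely_continuous a b g ->
  {ae mu, forall t, a < t < b -> derivable g t 1}.
Proof.
move=> ab acg.
have H (i : 'I_n) : {ae mu, forall t, a < t < b -> derivable (fun t => g t 0 i) t 1}.
  apply: bounded_variation_ae_derivable => //.
    move=> t abt; have gt := absolutely_continuous_continuous acg abt.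
    by apply: (@cvg_comp _ _ _ g (fun M : 'rV[R]_n => M 0 i) _ _ _ gt); exact: coord_continuous.
  exact: absolutely_continuous_bounded_variation.
have := filter_forall (ae_filter_ringOfSetsType mu) H.
apply: filterS => t tab abt; apply/derivable_mxP => i j.
by rewrite (ord1 i); exact: tab.
Qed.

End differentiation.

(** * The gradient of the objective *)

Section scaled_entry.
Context {R : realType} (n : nat) (c : R) (i : 'I_n).

(** Serves as the differential of [f]; it is named so that it can carry a linear structure. *)
Definition scaled_entry (v : 'rV[R]_n) : R := c * v 0 i.

Let scaled_entry_is_linear : linear scaled_entry.
Proof. by move=> a u v; rewrite /scaled_entry !mxE mulrDr mulrCA. Qed.

HB.instance Definition _ := GRing.isLinear.Build R 'rV[R]_n R *%R
  scaled_entry scaled_entry_is_linear.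
End scaled_entry.

Section heavy_ball.
Context {R : realType}.
Notation mu := (@lebesgue_measure R).

(** A quadratic remainder is little-o of the increment, and a bounded [L] is continuous, so
    uniqueness identifies the differential. Applied with [K = 1] to [f], and with [K = 0] to the
    Heavy-Ball map where it is locally linear. *)
Lemma differentiable_quadratic (V W : normedModType R) (f : V -> W)
    (L : {linear V -> W}) (x : V) (C K : R) : 0 <= K ->
  (forall v, `|L v| <= C * `|v|) ->
  (\forall y \near x, `|f y - f x - L (y - x)| <= K * `|y - x| ^+ 2) ->
  differentiable f x /\ 'd f x = L :> (V -> W).
Proof.
move=> K0 LC fL.
have cL : continuous L.
  move=> u; apply/cvgrPdist_lt => e e0.
  have C0 : 0 < `|C| + 1 by rewrite ltr_wpDl.
  apply/nbhs_ballP; exists (e / (`|C| + 1)); first by rewrite /= divr_gt0.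
  move=> v; rewrite -ball_normE /= => uv.
  rewrite -linearB; apply: (le_lt_trans (LC _)).
  apply: (@le_lt_trans _ _ ((`|C| + 1) * `|u - v|)).
    by rewrite ler_wpM2r// (le_trans (ler_norm C))// lerDl.
  by rewrite mulrC -ltr_pdivlMr.
have fxL : f \o shift x = cst (f x) + L +o_ 0 id.
  have /nbhs_ballP[d /= d0 fd] := fL.
  apply/eqaddoP => e /= e0; near=> h.
  have hd : `|h| < d by near: h; exact: nbhs0_lt.
  have he : `|h| <= e / (K + 1).
    by near: h; apply: nbhs0_le; rewrite divr_gt0// ltr_wpDl.
  have := fd (h + x); rewrite -ball_normE /= opprD addrCA subrr addr0 normrN addrK.
  move=> /(_ hd) fh.
  rewrite [X in `|X|](_ : _ = f (h + x) - f x - L h); last first.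
    by rewrite /= !fctE opprD addrA.
  apply: (le_trans fh); rewrite expr2 mulrA ler_wpM2r//.
  move: he; rewrite ler_pdivlMr ?ltr_wpDl// => he.
  by rewrite mulrC (le_trans _ he)// ler_wpM2l// lerDl.
have dL := diff_unique cL fxL; split => //.
by apply/diff_locallyP; rewrite dL.
Unshelve. all: by end_near. Qed.

Definition half_square (x : R) : R := if 0 <= x then x ^+ 2 / 2 else x ^+ 2 / 8.
(** The derivative of [half_square]. *)
Definition kink (x : R) : R := if 0 <= x then x else x / 4.

(** For equal signs the remainder is [(y - x) ^+ 2] over 2 or 8. For opposite signs [x * y <= 0], so
    [(y - x) ^+ 2] dominates [x ^+ 2 + y ^+ 2]. *)
Lemma half_square_kink x y :
  `|half_square y - half_square x - kink x * (y - x)| <= (y - x) ^+ 2.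
Proof.
have xx := sqr_ge0 x; have yy := sqr_ge0 y; have xy := sqr_ge0 (y - x).
rewrite ler_norml /half_square /kink; apply/andP.
case: (leP 0 x) => [x0|/ltW x0]; case: (leP 0 y) => [y0|/ltW y0]; first by split; lra.
- by have := mulr_ge0_le0 x0 y0 => ?; split; nra.
- by have := mulr_ge0_le0 y0 x0 => ?; split; nra.
- by split; lra.
Qed.

Lemma kink_lipschitz x y : `|kink x - kink y| <= `|x - y|.
Proof.
rewrite ler_norml /kink; have := ler_norm (x - y); have := ler_norm (- (x - y)).
rewrite normrN.
by case: (leP 0 x); case: (leP 0 y) => ? ? ? ?; apply/andP; split; lra.
Qed.

Lemma rv2_eta (z : 'rV[R]_2) : rv2 (z 0 0) (z 0 1) = z.
Proof.
apply/rowP => j; rewrite !mxE; case: ifPn => [/eqP->//|j0].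
by congr (z _ _); apply/val_inj; case: j j0 => -[|[|]].
Qed.

Section gradient.
Variable f : 'rV[R]_2 -> R.
Hypothesis f_def : forall x theta : R,
  f (rv2 x theta) = if 0 <= x then x ^+ 2 / 2 else x ^+ 2 / 8.

Lemma f_half_square z : f z = half_square (z 0 0).
Proof. by rewrite -{1}(rv2_eta z) f_def. Qed.

Lemma f_diff z : differentiable f z /\
  'd f z = scaled_entry (kink (z 0 0)) 0 :> ('rV[R]_2 -> R).
Proof.
apply: (@differentiable_quadratic _ _ _ _ _ `|kink (z 0 0)| 1) => //.
  by move=> v; rewrite normrM ler_wpM2l// ler_mx_entry.
near=> y; rewrite !f_half_square.
rewrite [X in _ - X](_ : _ = kink (z 0 0) * (y 0 0 - z 0 0)); last first.
  by rewrite /= /scaled_entry !mxE.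
have := half_square_kink (z 0 0) (y 0 0).
have := ler_mx_entry (y - z) 0 0; rewrite !mxE.
move=> yz /le_trans; apply; rewrite mul1r -(real_normK (num_real (_ - _))).
by rewrite lerXn2r ?nnegrE.
Unshelve. all: by end_near. Qed.

Lemma gradient_f z : gradient f z = rv2 (kink (z 0 0)) 0.
Proof.
apply/rowP => j; rewrite !mxE deriveE; last exact: (f_diff z).1.
rewrite (f_diff z).2 /scaled_entry mxE eqxx/= eq_sym.
by case: eqP => _; rewrite ?mulr1 ?mulr0.
Qed.

End gradient.

(** * Path differentiability of the gradient *)

Lemma kink_derivable (X : R -> R) (t : R) : derivable X t 1 ->
  ~ isolated [set s | X s = 0] t ->
  exists2 c : R, is_derive t 1 (kink \o X) c &
    (0 < X t -> c = 'D_1 X t) /\ (X t < 0 -> c = 'D_1 X t / 4) /\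
    (X t = 0 -> c = 0 /\ 'D_1 X t = 0).
Proof.
move=> dX niso.
have cX : {for t, continuous X}.
  by apply: differentiable_continuous; apply/derivable1_diffP.
have [X0|X0|X0] := ltgtP (X t) 0.
- exists ('D_1 X t / 4).
  2: by split=> //; split=> // Xt; move: X0; rewrite Xt ltxx.
  have Xneg : \forall s \near t, X s < 0 by exact: (cvgr_lt _ cX).
  have E : \forall s \near t, (fun s => 4^-1 *: X s) s = (kink \o X) s.
    near=> s; have Xs : X s < 0 by near: s.
    by rewrite /= /kink leNgt Xs/= mulrC.
  apply: (near_eq_is_derive E).
  by rewrite mulrC; apply: is_deriveZ; apply/derivableP.
- exists ('D_1 X t).
  2: by split=> //; split=> // Xt; move: X0; rewrite Xt ltxx.
  have Xpos : \forall s \near t, 0 < X s by exact: (cvgr_gt _ cX).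
  have E : \forall s \near t, X s = (kink \o X) s.
    near=> s; have Xs : 0 < X s by near: s.
    by rewrite /= /kink ltW.
  apply: (near_eq_is_derive E).
  by apply/derivableP.
have qX : h^-1 *: (X (h *: 1 + t) - X t) @[h --> 0^'] --> 'D_1 X t by exact: dX.
(* A nonzero derivative would make [t] an isolated zero. With derivative 0, the bound of [kink] by
   the identity makes the quotients of [kink \o X] vanish too. *)
have DX0 : 'D_1 X t = 0.
  apply/eqP; apply: contrapT => /negP DX; apply: niso; split; first by rewrite inE.
  have /cvgrPdist_lt/(_ `|'D_1 X t|) := qX.
  rewrite normr_gt0 => /(_ DX); rewrite /dnbhs near_withinE => /nbhs_ballP[d /= d0 H].
  exists (ball t d); first exact: nbhsx_ballx.
  apply/seteqP; split => [s [ts /= Xs]|s ->]; last by split => //; exact: ballxx.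
  apply/eqP; apply: contrapT => /negP st.
  have := H (s - t); rewrite /ball /= sub0r normrN -(distrC t) subr_eq0.
  move=> /(_ ts st); rewrite /GRing.scale/= mulr1 subrK Xs X0 subrr mulr0 subr0.
  by rewrite ltxx.
exists 0; last by [].
have kX : h^-1 *: ((kink \o X) (h *: 1 + t) - (kink \o X) t) @[h --> 0^'] --> (0 : R).
  apply/cvgrPdist_le => e e0.
  rewrite DX0 in qX; move/cvgrPdist_le: qX => /(_ _ e0); apply: filterS => h.
  rewrite !sub0r !normrN !normrZ; apply: le_trans.
  by rewrite ler_wpM2l// kink_lipschitz.
by split; [apply/cvg_ex; exists 0|apply/cvg_lim].
Unshelve. all: by end_near. Qed.

(** The Clarke Jacobian of the gradient: the corner entry is 1/4 for [z 0 0 < 0], 1 for [z 0 0 > 0]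
    and anything in [[1/4, 1]] at 0. Writing the cases as continuous equations makes the graph
    visibly closed. *)
Definition kink_jacobian (z : 'rV[R]_2) : set 'M[R]_2 :=
  [set V | [/\ 1 / 4 <= V 0 0 <= 1,
    (V 0 0 - 1 / 4) * (z 0 0 - `|z 0 0|) = 0,
    (V 0 0 - 1) * (z 0 0 + `|z 0 0|) = 0 &
    [/\ V 0 1 = 0, V 1 0 = 0 & V 1 1 = 0]]].

Lemma forall_I2 (P : 'I_2 -> Prop) : P 0 -> P 1 -> forall j, P j.
Proof.
move=> P0 P1 [[|[|//]] i2].
  by rewrite (_ : Ordinal _ = 0)//; exact: val_inj.
by rewrite (_ : Ordinal _ = 1)//; exact: val_inj.
Qed.

Lemma closed_kink_jacobian :
  closed [set p : 'rV[R]_2 * 'M[R]_2 | kink_jacobian p.1 p.2].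
Proof.
pose T := ('rV[R]_2 * 'M[R]_2)%type.
have cz : continuous (fun p : 'rV[R]_2 * 'M[R]_2 => p.1 0 0).
  move=> p; apply: (@cvg_comp _ _ _ fst (fun z : 'rV[R]_2 => z 0 0) _ (nbhs p.1)).
    exact: cvg_fst.
  exact: coord_continuous.
have cV i j : continuous (fun p : 'rV[R]_2 * 'M[R]_2 => p.2 i j).
  move=> p; apply: (@cvg_comp _ _ _ snd (fun z : 'M[R]_2 => z i j) _ (nbhs p.2)).
    exact: cvg_snd.
  exact: coord_continuous.
have cn : continuous (fun p : 'rV[R]_2 * 'M[R]_2 => `|p.1 0 0|).
  by move=> p; apply: cvg_norm; exact: cz.
have c0 (phi : 'rV[R]_2 * 'M[R]_2 -> R) : continuous phi -> closed [set p | phi p = 0].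
  move=> /continuous_closedP/(_ [set 0]); apply; exact: closed_eq.
have -> : [set p : T | kink_jacobian p.1 p.2] =
  ([set p : T | 1 / 4 <= p.2 0 0] `&` [set p : T | p.2 0 0 <= 1]) `&`
  ([set p : T | (p.2 0 0 - 1 / 4) * (p.1 0 0 - `|p.1 0 0|) = 0] `&`
   [set p : T | (p.2 0 0 - 1) * (p.1 0 0 + `|p.1 0 0|) = 0]) `&`
  ([set p : T | p.2 0 1 = 0] `&` [set p : T | p.2 1 0 = 0] `&` [set p : T | p.2 1 1 = 0]).
  by apply/seteqP; split => [p [/andP[? ?] ? ? [? ? ?]]//|p [[[? ?] [? ?]] [[? ?] ?]]];
    split => //; apply/andP.
have cM a : continuous (fun p : 'rV[R]_2 * 'M[R]_2 => p.2 0 0 - a).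
  by move=> p; exact: (continuousB (cV 0 0 p) (@cst_continuous T R a p)).
apply: closedI; [apply: closedI; [apply: closedI|apply: closedI]|apply: closedI; [apply: closedI|]].
- exact: ((continuous_closedP _).1 (cV 0 0) _ (@closed_ge R (1 / 4))).
- exact: ((continuous_closedP _).1 (cV 0 0) _ (@closed_le R 1)).
- by apply: c0 => p; exact: (continuousM (cM _ p) (continuousB (cz p) (cn p))).
- by apply: c0 => p; exact: (continuousM (cM _ p) (continuousD (cz p) (cn p))).
- exact/c0/cV.
- exact/c0/cV.
- exact/c0/cV.
Qed.

Lemma kink_conservative :
  conservative_jacobian (fun z : 'rV[R]_2 => rv2 (kink (z 0 0)) 0) kink_jacobian.
Proof.
split.
- exact: closed_kink_jacobian.
- move=> z; exists setT; first exact: filterT.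
  exists 1; split; first exact: num_real.
  move=> M /ltW M1 V /= [y _ [/andP[V0 V1] _ _ [V01 V10 V11]]].
  apply: (le_trans _ M1); apply: mx_norm_le => // i j.
  move: i; apply: forall_I2; move: j; apply: forall_I2;
    rewrite ?V01 ?V10 ?V11 ?normr0// ger0_norm//; lra.
- move=> z; exists (mx2 (if 0 <= z 0 0 then 1 else 1 / 4) 0 0 0).
  rewrite /kink_jacobian/= !mxE/=.
  have [z0|z0] := leP 0 (z 0 0).
    by rewrite (ger0_norm z0) !subrr mulr0 mul0r; split => //; lra.
  by rewrite (ltr0_norm z0) !subrr mulr0 mul0r; split => //; lra.
- move=> g acg.
  pose X t := g t 0 0.
  have iso : mu.-negligible (isolated [set s | X s = 0]).
    have cS := countable_isolated [set s | X s = 0].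
    exists (isolated [set s | X s = 0]); split => //.
    + exact: countable_measurable.
    + exact: countable_lebesgue_measure0.
  have N01 : mu.-negligible [set (0 : R); 1].
    exists [set (0:R); 1]; split => //.
    + by apply: measurableU; exact: measurable_set1.
    + exact: (countable_lebesgue_measure0 (finite_set_countable (finite_set2 0 1))).
  have acd := absolutely_continuous_ae_derivable ltr01 acg.
  apply: negligibleS (negligibleU acd (negligibleU iso N01)) => t /= /not_implyP[].
  rewrite in_itv/= => /andP[t0 t1] bad.
  apply: contrapT => /not_orP[dg /not_orP[niso /not_orP[tn0 tn1]]]; apply: bad.
  have t01 : 0 < t < 1 by rewrite !lt_neqAle t0 t1 !andbT eq_sym; apply/andP; split; apply/eqP.
  have {}dg : derivable g t 1 by apply: contrapT => ndg; apply: dg; exact/not_implyP.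
  have dX : derivable X t 1 by move/derivable_mxP : dg; exact.
  have [c [kd kc] [cpos [cneg c0]]] := kink_derivable dX niso.
  have dh : derivable ((fun z : 'rV[R]_2 => rv2 (kink (z 0 0)) 0) \o g) t 1.
    apply/derivable_mxP => i; apply: forall_I2; rewrite (ord1 i).
      rewrite [X in derivable X](_ : _ = kink \o X)//.
      by apply/funext => s; rewrite /= mxE.
    rewrite [X in derivable X](_ : _ = cst 0); first exact: derivable_cst.
    by apply/funext => s; rewrite /= mxE.
  split => // V [/andP[V0 V1] Vneg Vpos [V01 V10 V11]].
  rewrite !derive1E derive_mx// (derive_mx dg).
  apply/rowP; apply: forall_I2; rewrite !mxE !big_ord_recl big_ord0 !mxE/=.
    rewrite (_ : (fun _ => _) = kink \o X); last by apply/funext => s; rewrite mxE.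
    rewrite kc (_ : lift ord0 ord0 = 1); last exact: val_inj.
    rewrite V01 mulr0 !addr0 -/X.
    change ('D_1 (fun t0 => g t0 0 0) t) with ('D_1 X t).
    have [Xt|Xt|Xt] := ltgtP (X t) 0.
    + have -> : V 0 0 = 1 / 4.
        move/eqP: Vneg; rewrite -/(X t) ltr0_norm// mulf_eq0 => /orP[/eqP|/eqP]; lra.
      by rewrite cneg// div1r.
    + have -> : V 0 0 = 1.
        move/eqP: Vpos; rewrite -/(X t) gtr0_norm// mulf_eq0 => /orP[/eqP|/eqP]; lra.
      by rewrite cpos// mulr1.
    (* Here [V 0 0] is not determined, but both derivatives vanish. *)
    + by have [-> ->] := c0 Xt; rewrite mul0r.
  rewrite (_ : (fun _ => _) = cst 0); last by apply/funext => s; rewrite mxE.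
  rewrite derive_cst (_ : lift ord0 ord0 = 1); last exact: val_inj.
  by rewrite V10 V11 !mulr0 !addr0.
Qed.

Lemma kink_locally_lipschitz :
  locally_lipschitz (fun z : 'rV[R]_2 => rv2 (kink (z 0 0)) 0).
Proof.
move=> z; exists 1; exists setT; first exact: filterT.
move=> [x y] _ /=; rewrite mul1r; apply: mx_norm_le => // i.
apply: forall_I2; rewrite (ord1 i) !mxE/= ?subrr ?normr0//.
apply: (le_trans (kink_lipschitz _ _)).
by have := ler_mx_entry (x - y) 0 0; rewrite !mxE.
Qed.

(** * Clarke Jacobian of the Heavy-Ball map and the matrix product *)

Definition hb_map (z : 'rV[R]_2) : 'rV[R]_2 :=
  rv2 (z 0 0 - kink (z 0 0) + 3 / 4 * (z 0 0 - z 0 1)) (z 0 0).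

Let M1 : 'M[R]_2 := mx2 (3 / 2) (- (3 / 4)) 1 0.
Let M2 : 'M[R]_2 := mx2 (3 / 4) (- (3 / 4)) 1 0.

Lemma mul_rv_tr_mx2 (z : 'rV[R]_2) a b c d :
  z *m (mx2 a b c d)^T = rv2 (a * z 0 0 + b * z 0 1) (c * z 0 0 + d * z 0 1).
Proof.
apply/rowP; apply: forall_I2; rewrite !mxE !big_ord_recl big_ord0 !mxE/=;
  by rewrite addr0 (mulrC (z _ _)) (mulrC (z _ _)) (_ : lift ord0 ord0 = 1)//; exact: val_inj.
Qed.

Lemma mulmxr_norm n m (M : 'M[R]_(n, m)) (v : 'rV[R]_n) :
  `|v *m M| <= n%:R * `|M| * `|v|.
Proof.
apply: mx_norm_le => [|i j]; first by rewrite !mulr_ge0.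
rewrite mxE (le_trans (ler_norm_sum _ _ _))//.
apply: (@le_trans _ _ (\sum_(k < n) `|M| * `|v|)).
  apply: ler_sum => k _; rewrite normrM mulrC ler_pM//; exact: ler_mx_entry.
by rewrite sumr_const card_ord -[leLHS]mulr_natl mulrA.
Qed.

Lemma hb_map_linear z (M : 'M[R]_2) :
  (\forall y \near z, hb_map y = y *m M^T) ->
  differentiable hb_map z /\ ('J hb_map z)^T = M.
Proof.
move=> zM.
have [|||dh dE] := @differentiable_quadratic _ _ hb_map (mulmxr M^T) z (2%:R * `|M^T|) 0.
- by [].
- by move=> v; exact: mulmxr_norm.
- have zz := nbhs_singleton zM.
  apply: filterS zM => y yM.
  by rewrite yM zz /= mulmxBl subrr normr0 mul0r.
split => //; rewrite /jacobian.
have -> : lin1_mx ('d hb_map z) = lin1_mx (mulmxr M^T) :> 'M[R]_2.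
  by apply/matrixP => i j; rewrite [LHS]mxE [RHS]mxE dE.
by apply/matrixP => i j; rewrite mxE mxE /= -rowE !mxE.
Qed.

Lemma hb_map_jacobian_pos (z : 'rV[R]_2) : 0 < z 0 0 ->
  differentiable hb_map z /\ ('J hb_map z)^T = M2.
Proof.
move=> z0; apply: hb_map_linear.
have : \forall y \near z, 0 < (y : 'rV[R]_2) 0 0.
  exact: (cvgr_gt _ (@coord_continuous _ _ _ 0 0 z)).
apply: filterS => y y0; rewrite mul_rv_tr_mx2 /hb_map /kink ltW//.
by congr rv2; lra.
Qed.

Lemma hb_map_jacobian_neg (z : 'rV[R]_2) : z 0 0 < 0 ->
  differentiable hb_map z /\ ('J hb_map z)^T = M1.
Proof.
move=> z0; apply: hb_map_linear.
have : \forall y \near z, (y : 'rV[R]_2) 0 0 < 0.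
  exact: (cvgr_lt _ (@coord_continuous _ _ _ 0 0 z)).
apply: filterS => y y0; rewrite mul_rv_tr_mx2 /hb_map /kink leNgt y0/=.
by congr rv2; lra.
Qed.

Lemma hb_map_not_differentiable (z : 'rV[R]_2) : z 0 0 = 0 -> ~ differentiable hb_map z.
Proof.
move=> z0 dh.
have /derivable_mxP/(_ 0 0)/cvg_ex[l] := @diff_derivable _ _ _ hb_map z (delta_mx 0 0) dh.
(* The one-sided slopes of the first coordinate are 3/4 and 3/2, which cannot both be within 1/8 of
   [l]. *)
have e0 : (0 : R) < 1 / 8 by lra.
move=> /cvgrPdist_lt/(_ _ e0); rewrite /dnbhs near_withinE => /nbhs_ballP[d /= d0 H].
have q h : hb_map (h *: delta_mx 0 0 + z) 0 0 - hb_map z 0 0 = h - kink h + 3 / 4 * h.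
  rewrite !mxE/= z0 mulr1 mulr0 !addr0 add0r /kink lexx; lra.
have h1 : ball (0 : R) d (d / 2).
  by rewrite /ball/= sub0r normrN gtr0_norm; lra.
have h2 : ball (0 : R) d (- (d / 2)).
  by rewrite /ball/= sub0r opprK gtr0_norm; lra.
have d20 : d / 2 != 0 by lra.
have := H _ h1 d20; have := H _ h2; rewrite oppr_eq0 => /(_ d20).
rewrite !q /GRing.scale/= /kink oppr_ge0.
have -> : (0 <= d / 2) = true by lra.
have -> : (d / 2 <= 0) = false by lra.
rewrite (_ : (d / 2)^-1 * _ = 3 / 4); last by field; lra.
rewrite (_ : (- (d / 2))^-1 * _ = 3 / 2); last by field; lra.
by rewrite !ltr_norml => /andP[? ?] /andP[? ?]; lra.
Qed.

Lemma rv2_harmonic_cvg (s : R) : `|s| <= 1 ->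
  rv2 (s / k.+1%:R) 0 @[k --> \oo] --> (0 : 'rV[R]_2).
Proof.
move=> s1; apply/cvgrPdist_le => e e0.
have /cvgrPdist_le/(_ _ e0) := @cvg_harmonic R; apply: filterS => k.
rewrite !sub0r !normrN => ke; apply: (le_trans _ ke).
apply: mx_norm_le => // i; apply: forall_I2; rewrite mxE/= ?normr0//.
by rewrite normrM ler_piMl.
Qed.

(** The generating sets agree before taking hulls: Jacobians take only the values [M1] and [M2], a
    closed set, and each is reached along a sequence from its own side of the line. *)
Lemma clarke_jacobian_hb_map :
  clarke_jacobian hb_map 0 = convex_hull [set M1; M2].
Proof.
congr convex_hull; apply/seteqP; split => [V [zk [zk0 dzk JV]]|V].
  have cM : closed [set M1; M2].
    by apply: closedU; apply: compact_closed; 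
      [exact: norm_hausdorff|exact: compact_set1|exact: norm_hausdorff|exact: compact_set1].
  apply: (closed_cvg _ cM _ _ JV); near=> k.
  have [k0|k0|k0] := ltgtP (zk k 0 0) 0.
  - by left; exact: (hb_map_jacobian_neg k0).2.
  - by right; exact: (hb_map_jacobian_pos k0).2.
  - by have := hb_map_not_differentiable k0 (dzk k).
case=> ->.
- exists (fun k => rv2 (- 1 / k.+1%:R) 0).
  have neg k : rv2 (- 1 / k.+1%:R) 0 0 0 < 0 :> R.
    by rewrite mxE/= mulNr oppr_lt0 divr_gt0// ltr0n.
  split.
  + by apply: rv2_harmonic_cvg; rewrite normrN normr1.
  + by move=> k; exact: (hb_map_jacobian_neg (neg k)).1.
  + rewrite (_ : (fun k => _) = cst M1); first exact: cvg_cst.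
    by apply/funext => k; exact: (hb_map_jacobian_neg (neg k)).2.
- exists (fun k => rv2 (1 / k.+1%:R) 0).
  have pos k : 0 < rv2 (1 / k.+1%:R) 0 0 0 :> R.
    by rewrite mxE/= divr_gt0// ltr0n.
  split.
  + by apply: rv2_harmonic_cvg; rewrite normr1.
  + by move=> k; exact: (hb_map_jacobian_pos (pos k)).1.
  + rewrite (_ : (fun k => _) = cst M2); first exact: cvg_cst.
    by apply/funext => k; exact: (hb_map_jacobian_pos (pos k)).2.
Unshelve. all: by end_near. Qed.

Lemma eigenvalue_M1M1M2M2 : eigenvalue (M1 *m M1 *m M2 *m M2) (- (9 / 8)).
Proof.
(* Eigenvectors are rows here. The successive factors send (1, 0) to (3/2, -3/4), (3/2, -9/8), (0,
   -9/8) and (-9/8, 0). *)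
apply/eigenvalueP; exists (rv2 1 0); last first.
  by apply/eqP => /rowP/(_ 0); rewrite !mxE/= => /eqP; rewrite oner_eq0.
apply/rowP; apply: forall_I2;
  do 4 (rewrite ?mulmxA); rewrite !(mxE, big_ord_recl, big_ord0)/=; lra.
Qed.

(** * Global convergence of the Heavy-Ball iteration *)

Definition hb_step (x y : R) : R :=
  if 0 <= x then 3 / 4 * (x - y) else 3 / 2 * x - 3 / 4 * y.

(* For b = 1, the polygon with vertices (-13/8, -15/8), (0, -5/4), (1, 0),
   (3/4, 9/8), (0, 9/8), (-1, 0) and (-13/8, -9/8). It is close to
   the smallest convex set that contains |x| + |y| <= 1 and is stable under
   (x, y) |-> (hb_step x y, x). *)
Definition heptagon (b x y : R) : Prop :=
  [/\ [/\ 4 / 13 * x - 4 / 5 * y <= b, x - 4 / 5 * y <= b & x + 2 / 9 * y <= b],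
      8 / 9 * y <= b & [/\ - x + 8 / 9 * y <= b, - x + 5 / 9 * y <= b & - (8 / 13) * x <= b]].

(** The step is linear on each half-plane, so every facet inequality of the image follows linearly
    from those of the heptagon and the sign of [x]. *)
Lemma heptagon_hb_step (b x y : R) :
  heptagon b x y -> heptagon (99 / 100 * b) (hb_step x y) x.
Proof.
move=> [[h1 h2 h3] h4 [h5 h6 h7]].
by rewrite /hb_step; case: leP => x0; split; [split| |split| split| |split]; lra.
Qed.

Lemma heptagon_norm (b x y : R) : heptagon b x y -> `|x| <= 2 * b /\ `|y| <= 2 * b.
Proof.
by move=> [[h1 h2 h3] h4 [h5 h6 h7]]; rewrite !ler_norml; split; apply/andP; split; lra.
Qed.

(** All facet coefficients have absolute value at most 1, so every starting point lies in some
    multiple of the heptagon. *)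
Lemma heptagon_total (x y : R) : heptagon (`|x| + `|y|) x y.
Proof.
have := ler_norm x; have := ler_norm y; have := ler_norm (- x); have := ler_norm (- y).
by rewrite !normrN => *; split; [split| |split]; lra.
Qed.

Lemma cvg_iter_hb_map (z0 : 'rV[R]_2) :
  iter k hb_map z0 @[k --> \oo] --> (0 : 'rV[R]_2).
Proof.
pose b := `|z0 0 0| + `|z0 0 1|.
have hbE z : hb_map z = rv2 (hb_step (z 0 0) (z 0 1)) (z 0 0).
  by rewrite /hb_map /hb_step /kink; congr rv2; case: leP => _; lra.
have hept k : heptagon ((99 / 100) ^+ k * b) (iter k hb_map z0 0 0) (iter k hb_map z0 0 1).
  elim: k => [|k IH]; first by rewrite expr0 mul1r; exact: heptagon_total.
  by rewrite exprS -mulrA iterS hbE !mxE; exact: heptagon_hb_step.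
have geo : 2 * ((99 / 100) ^+ k * b) @[k --> \oo] --> (0 : R).
  rewrite -[X in _ --> X](mulr0 2); apply: cvgM; first exact: cvg_cst.
  rewrite -[X in _ --> X](mul0r b); apply: cvgM; last exact: cvg_cst.
  by apply: cvg_expr; rewrite ger0_norm; lra.
apply/cvgrPdist_le => e e0.
move/cvgrPdist_le: geo => /(_ _ e0); apply: filterS => k.
rewrite !sub0r !normrN => /(le_trans (ler_norm _)) ke.
have [k0 k1] := heptagon_norm (hept k).
apply: (le_trans _ ke); apply: mx_norm_le => [|i]; first exact: le_trans k0.
by apply: forall_I2; rewrite (ord1 i).
Qed.

End heavy_ball.

Theorem proposition4 (R : realType) (f : 'rV[R]_2 -> R)
  (f_def : forall x theta : R,
     f (rv2 x theta) = if 0 <= x then x ^+ 2 / 2 else x ^+ 2 / 8) :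
  let alpha : R := 1 in
  let beta : R := 3 / 4 in
  let F (theta : R) (z : 'rV[R]_2) : 'rV[R]_2 :=
    heavy_ball alpha beta f (z 0 0) (z 0 1) theta in
  let M1 : 'M[R]_2 := mx2 (3 / 2) (- (3 / 4)) 1 0 in
  let M2 : 'M[R]_2 := mx2 (3 / 4) (- (3 / 4)) 1 0 in
  [/\ forall (theta : R) (z0 : 'rV[R]_2),
        iter k (F theta) z0 @[k --> \oo] --> (0 : 'rV[R]_2),
      forall z : 'rV[R]_2, differentiable f z,
      path_differentiable (gradient f),
      clarke_jacobian (F 0) 0 = convex_hull [set M1; M2] &
      eigenvalue (M1 *m M1 *m M2 *m M2) (- (9 / 8))].
Proof.
move=> alpha beta F M1 M2.
have gradE : gradient f = fun z => rv2 (kink (z 0 0)) 0.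
  by apply/funext => z; exact: gradient_f.
(* The gradient ignores [theta], so one map covers all parameters. *)
have FE theta : F theta = hb_map.
  by apply/funext => z; rewrite /F /heavy_ball gradE /alpha /beta mul1r !mxE/=.
split.
- by move=> theta z0; rewrite FE; exact: cvg_iter_hb_map.
- by move=> z; exact: (f_diff f_def z).1.
- rewrite gradE; split; first exact: kink_locally_lipschitz.
  by exists kink_jacobian; exact: kink_conservative.
- by rewrite FE; exact: clarke_jacobian_hb_map.
- exact: eigenvalue_M1M1M2M2.
Qed.
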